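(* Let $m\le n$. For a curve $a(t)$ in $M_+(n,m)$ put $L=a_ta^+$, $\delta=\operatorname{tr}(L^TL)$ and $\tau=\operatorname{tr}(L)$. The solution of the geodesic equation $$a_{tt} = a_t(a^Ta)^{-1}a_t^Ta + a_t(a^Ta)^{-1}a^Ta_t-a(a^Ta)^{-1}a_t^Ta_t+\tfrac12\operatorname{tr}\left(a_t(a^Ta)^{-1}a_t^T\right)a-\operatorname{tr}\left(a_t(a^Ta)^{-1}a^T\right)a_t$$ with initial values $a(0)\in M_+(n,m)$ and $L(0)=a_t(0)a(0)^+$ is given by $$a(t) = f(t)^{1/m}e^{-s(t)\omega_0}a(0)e^{s(t)P_0},$$ where $$f(t) = \frac{m\delta(0)}{4}t^2+\tau(0)t+1,\qquad s(t) = \int_0^t\frac{d\sigma}{f(\sigma)},$$ $$\omega_0 = L^T(0) - L(0),\qquad P_0 = (a(0)^Ta(0))^{-1}(a_t(0)^Ta(0)) - \frac{\tau(0)}{m}I_{m\times m},$$ and $I_{m\times m}$ is the $m\times m$ identity matrix.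
   Context: $M_+(n,m)$ is the set of real $n\times m$ matrices of rank $m$. For $a\in M_+(n,m)$, $a^+=(a^Ta)^{-1}a^T$ is the Moore–Penrose pseudo-inverse. The displayed equation is the geodesic equation on $M_+(n,m)$ of the Riemannian metric $\langle u,v\rangle_a=\operatorname{tr}(u(a^Ta)^{-1}v^T)\sqrt{\det(a^Ta)}$. Subscript $t$ denotes differentiation in $t$; $e^{(\cdot)}$ is the matrix exponential. *)

(* Defs.v *)
From HB Require Import structures.
From mathcomp Require Import all_boot all_order all_algebra.
From mathcomp Require Import all_classical all_reals all_analysis.

Set Implicit Arguments.
Unset Strict Implicit.
Unset Printing Implicit Defensive.

Import Order.TTheory GRing.Theory Num.Theory.
Import numFieldTopology.Exports numFieldNormedType.Exports.

Local Open Scope classical_set_scope.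
Local Open Scope ring_scope.

Definition full_rank (R : realType) (n m : nat) (a : 'M[R]_(n, m)) : Prop :=
  \rank a = m.

(* The formula for the pseudo-inverse is meaningful for [full_rank] matrices,
   for which [a^T *m a] is invertible. *)
Definition pinv (R : realType) (n m : nat) (a : 'M[R]_(n, m)) : 'M[R]_(m, n) :=
  invmx (a^T *m a) *m a^T.

(* Powers are matrix powers; the series converges in the norm topology. *)
Definition expmx (R : realType) (n : nat) (A : 'M[R]_n) : 'M[R]_n :=
  lim (series (fun k : nat => (k`!%:R)^-1 *: A ^+ k) @ \oo).

Definition integral_from0 (R : realType) (g : R -> R) (t : R) : R :=
  if 0 <= t then \int[lebesgue_measure]_(x in `[0, t]) g x
  else - \int[lebesgue_measure]_(x in `[t, 0]) g x.

(* [v] stands for the velocity of the curve at the point [a]. *)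
Definition geodesic_rhs (R : realType) (n m : nat) (a v : 'M[R]_(n, m)) :
    'M[R]_(n, m) :=
  v *m invmx (a^T *m a) *m v^T *m a
  + v *m invmx (a^T *m a) *m a^T *m v
  - a *m invmx (a^T *m a) *m v^T *m v
  + (2^-1 * \tr (v *m invmx (a^T *m a) *m v^T)) *: a
  - \tr (v *m invmx (a^T *m a) *m a^T) *: v.

Definition is_geodesic (R : realType) (n m : nat) (J : set R)
    (a : R -> 'M[R]_(n, m)) : Prop :=
  forall t : R, J t ->
    [/\ full_rank (a t), derivable a t 1, derivable (derive1 a) t 1
      & derive1 (derive1 a) t = geodesic_rhs (a t) (derive1 a t)].

Definition delta (R : realType) (n : nat) (L : 'M[R]_n) : R := \tr (L^T *m L).

Definition tau (R : realType) (n : nat) (L : 'M[R]_n) : R := \tr L.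

Definition geo_f (R : realType) (n m : nat) (a0 v0 : 'M[R]_(n, m)) (t : R) : R :=
  let L0 := v0 *m pinv a0 in
  m%:R * delta L0 / 4 * t ^+ 2 + tau L0 * t + 1.

Definition geo_s (R : realType) (n m : nat) (a0 v0 : 'M[R]_(n, m)) (t : R) : R :=
  integral_from0 (fun x : R => (geo_f a0 v0 x)^-1) t.

Definition omega0 (R : realType) (n m : nat) (a0 v0 : 'M[R]_(n, m)) : 'M[R]_n :=
  let L0 := v0 *m pinv a0 in L0^T - L0.

Definition P0 (R : realType) (n m : nat) (a0 v0 : 'M[R]_(n, m)) : 'M[R]_m :=
  invmx (a0^T *m a0) *m (v0^T *m a0)
  - (tau (v0 *m pinv a0) / m%:R) *: 1%:M.

Definition geodesic_formula (R : realType) (n m : nat)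
    (a0 v0 : 'M[R]_(n, m)) (t : R) : 'M[R]_(n, m) :=
  (geo_f a0 v0 t `^ (m%:R^-1)) *:
    (expmx (- geo_s a0 v0 t *: omega0 a0 v0) *m a0
      *m expmx (geo_s a0 v0 t *: P0 a0 v0)).

(* Main.v *)
Require Import Defs.
From HB Require Import structures.
From mathcomp Require Import all_boot all_order all_algebra perm.
From mathcomp Require Import all_classical all_reals all_analysis.
From mathcomp Require Import ring lra.
(* The names pinv and delta have homonyms among the imports above. *)
Import Defs.

Import Order.TTheory GRing.Theory Num.Theory.
Import numFieldTopology.Exports numFieldNormedType.Exports.

Local Open Scope classical_set_scope.
Local Open Scope ring_scope.

(** Write G for the inverse of a^T a, L = a_t G a^T, delta = tr (L^T L) and
    tau = tr L. In terms of L the geodesic equation reads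
      L_t = - tau L + (L L^T - L^T L) + (delta / 2) a G a^T,
    where the commutator is symmetric, has trace zero and is orthogonal to L.
    Taking the trace, the product with L and the skew part of this equation
    gives, with omega = L^T - L and P = G a_t^T a - tau / m,
      tau_t = m delta / 2 - tau^2,   delta_t = - tau delta,
      omega_t = - tau omega,         P_t = - tau P
    ([is_derive_tau], [is_derive_delta], [is_derive_omega0], [is_derive_P0]).

    Uniqueness. Let phi = exp (int_0^t tau), so that phi > 0 and
    phi_t = tau phi. Then phi delta, phi omega and phi P are constant, while
    phi_tt = (tau_t + tau^2) phi = m delta(0) / 2: phi is the quadratic f.
    Hence f is positive as long as the geodesic exists. Moreover
      a_t = - omega a + a P + (tau / m) a
          = (- omega_0 a + a P_0 + (f_t / m) a) / f
    ([velocity_decomposition]); this is a linear equation, and undoing the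
    frame f^(1/m) e^(-s omega_0) . e^(s P_0), where s_t = 1 / f, turns a into a
    constant curve.

    Existence. The right-hand side of the geodesic equation is equivariant
    under a |-> h U a E with h a nonzero number, U orthogonal and E invertible
    ([geodesic_rhs_equivariant]), and e^(-s omega_0) is orthogonal because
    omega_0 is skew. Seen from the moving frame, the position is the constant
    a_0, the velocity is (v_0 + (delta(0) t / 2) a_0) / f, and the equation
    becomes an identity between matrices built from a_0 and v_0
    ([geodesic_rhs_frame_vel]), which is where the coefficients of f matter.

    The analysis underneath is entrywise: product, inverse and chain rules for
    curves of matrices, termwise differentiation of the exponential series,
    and the fundamental theorem of calculus for s and for the exponent of
    phi. *)

Set Implicit Arguments.
Unset Strict Implicit.
Unset Printing Implicit Defensive.

(** * Calculus of curves of matrices *)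

Lemma is_derive_mxP (R : realType) (n m : nat) (M : R -> 'M[R]_(n, m)) (t : R)
    (dM : 'M[R]_(n, m)) :
  is_derive t 1 M dM <->
  forall i j, is_derive t 1 (fun x => M x i j) (dM i j).
Proof.
split=> [[dMt <-] i j|dMij].
  rewrite derive_mx// mxE; apply: derivableP.
  by move/derivable_mxP: dMt.
have dMt : derivable M t 1 by apply/derivable_mxP => i j; case: (dMij i j).
apply: DeriveDef => //; rewrite derive_mx//; apply/matrixP => i j.
by rewrite mxE; case: (dMij i j).
Qed.

Lemma is_derive_sum_fun (R : realType) (I : Type) (r : seq I)
    (F : I -> R -> R) (dF : I -> R) (t : R) :
  (forall i, is_derive t 1 (F i) (dF i)) ->
  is_derive t 1 (fun x => \sum_(i <- r) F i x) (\sum_(i <- r) dF i).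
Proof.
move=> dFi; elim: r => [|i r IHr].
  rewrite big_nil; under eq_fun do rewrite big_nil.
  exact: is_derive_cst.
rewrite big_cons; under eq_fun do rewrite big_cons.
exact: (is_deriveD (dFi i) IHr).
Qed.

Lemma is_derive_mul_fun (R : realType) (f g : R -> R) (t df dg : R) :
  is_derive t 1 f df -> is_derive t 1 g dg ->
  is_derive t 1 (fun x => f x * g x) (df * g t + f t * dg).
Proof.
move=> dft dgt; apply: (is_derive_eq (is_deriveM dft dgt)).
by rewrite addrC; congr (_ + _); rewrite mulrC.
Qed.

Lemma is_derive_mulmx (R : realType) (n m p : nat) (M : R -> 'M[R]_(n, m))
    (N : R -> 'M[R]_(m, p)) (t : R) (dM : 'M[R]_(n, m)) (dN : 'M[R]_(m, p)) :
  is_derive t 1 M dM -> is_derive t 1 N dN ->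
  is_derive t 1 (fun x => M x *m N x) (dM *m N t + M t *m dN).
Proof.
move=> /is_derive_mxP dMt /is_derive_mxP dNt; apply/is_derive_mxP => i k.
rewrite 3!mxE -big_split/=; under eq_fun do rewrite mxE.
by apply: is_derive_sum_fun => j; exact: is_derive_mul_fun.
Qed.

Lemma is_derive_scalemx (R : realType) (n m : nat) (c : R -> R)
    (M : R -> 'M[R]_(n, m)) (t dc : R) (dM : 'M[R]_(n, m)) :
  is_derive t 1 c dc -> is_derive t 1 M dM ->
  is_derive t 1 (fun x => c x *: M x) (dc *: M t + c t *: dM).
Proof.
move=> dct /is_derive_mxP dMt; apply/is_derive_mxP => i j.
by rewrite 3!mxE; under eq_fun do rewrite mxE; exact: is_derive_mul_fun.
Qed.

Lemma is_derive_trmx (R : realType) (n m : nat) (M : R -> 'M[R]_(n, m))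
    (t : R) (dM : 'M[R]_(n, m)) :
  is_derive t 1 M dM -> is_derive t 1 (fun x => (M x)^T) dM^T.
Proof.
move=> /is_derive_mxP dMt; apply/is_derive_mxP => i j.
by rewrite mxE; under eq_fun do rewrite mxE.
Qed.

Lemma is_derive_mxtrace (R : realType) (n : nat) (M : R -> 'M[R]_n)
    (t : R) (dM : 'M[R]_n) :
  is_derive t 1 M dM -> is_derive t 1 (fun x => \tr (M x)) (\tr dM).
Proof. by move=> /is_derive_mxP dMt; exact: is_derive_sum_fun. Qed.

Lemma is_derive_mx_comp (R : realType) (n m : nat) (M : R -> 'M[R]_(n, m))
    (s : R -> R) (t ds : R) (dM : 'M[R]_(n, m)) :
  is_derive (s t) 1 M dM -> is_derive t 1 s ds ->
  is_derive t 1 (fun x => M (s x)) (ds *: dM).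
Proof.
move=> /is_derive_mxP dMt dst; apply/is_derive_mxP => i j.
by rewrite mxE mulrC; exact: (is_derive1_comp (dMt i j) dst).
Qed.

(** The mean value theorem; it turns each evolution equation below into a
    conservation law. *)
Lemma derive0_cst_interval (R : realType) (J : set R) (f : R -> R) (x y : R) :
  is_interval J -> (forall t, J t -> is_derive t 1 f 0) ->
  J x -> J y -> f x = f y.
Proof.
move=> Jitv df.
wlog xLy : x y / x <= y => [H Jx Jy|Jx Jy].
  by case: (leP x y) => [|/ltW] xy; [|symmetry]; exact: H.
have inJ t : t \in `[x, y] -> J t.
  by rewrite in_itv/= => xty; exact: Jitv Jx Jy _ xty.
have dfJ t : t \in `]x, y[ -> is_derive t 1 f 0.
  by move=> /subset_itv_oo_cc/inJ/df.
have [|c _] := MVT_segment xLy dfJ.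
  apply: derivable_within_continuous => t /inJ/df[] //.
by rewrite mul0r => /eqP; rewrite subr_eq0 => /eqP ->.
Qed.

Lemma derive0_cst_interval_mx (R : realType) (n m : nat) (J : set R)
    (M : R -> 'M[R]_(n, m)) (x y : R) :
  is_interval J -> (forall t, J t -> is_derive t 1 M 0) ->
  J x -> J y -> M x = M y.
Proof.
move=> Jitv dM Jx Jy; apply/matrixP => i j.
apply: (@derive0_cst_interval _ J (fun t => M t i j)) => // t Jt.
by have /is_derive_mxP/(_ i j) := dM t Jt; rewrite mxE.
Qed.

Lemma derivable_prod_fun (R : realType) (I : Type) (r : seq I)
    (F : I -> R -> R) (t : R) :
  (forall i, derivable (F i) t 1) ->
  derivable (fun x => \prod_(i <- r) F i x) t 1.
Proof.
move=> dF; elim: r => [|i r IHr].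
  by under eq_fun do rewrite big_nil; exact: derivable_cst.
under eq_fun do rewrite big_cons.
by have /derivableP di := dF i; have /derivableP dr := IHr;
  case: (is_derive_mul_fun di dr).
Qed.

Lemma derivable_det (R : realType) (n : nat) (M : R -> 'M[R]_n) (t : R) :
  derivable M t 1 -> derivable (fun x => \det (M x)) t 1.
Proof.
move=> /derivable_mxP dM; rewrite /determinant.
pose F (s : 'S_n) x := (-1) ^+ s * \prod_i M x i (s i) : R.
suff dF s : derivable (F s) t 1.
  have /(is_derive_sum_fun (index_enum _))[//] :
    forall s, is_derive t 1 (F s) ('D_1 (F s) t) by move=> s; exact: derivableP.
have /derivableP dp : derivable (fun x => \prod_i M x i (s i)) t 1.
  exact: derivable_prod_fun.
by case: (is_derive_mul_fun (is_derive_cst ((-1) ^+ s : R) t 1) dp).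
Qed.

(** Near [t] the inverse is given by Cramer's rule, and the determinant and the
    cofactors are polynomials in the entries. *)
Lemma derivable_invmx (R : realType) (n : nat) (M : R -> 'M[R]_n) (t : R) :
  derivable M t 1 -> (\forall x \near t, M x \in unitmx) ->
  derivable (fun x => invmx (M x)) t 1.
Proof.
move=> dM Munit.
apply: (@near_eq_derivable _ _ _ (fun x => (\det (M x))^-1 *: \adj (M x))).
  by near=> x; rewrite /invmx ifT//; near: x.
have detn0 : \det (M t) != 0.
  by have := nbhs_singleton Munit; rewrite unitmxE unitfE.
have /derivableP dV : derivable (fun x => (\det (M x))^-1) t 1.
  by apply: derivableV => //; exact: derivable_det.
suff /derivableP dA : derivable (fun x => \adj (M x)) t 1.
  by case: (is_derive_scalemx dV dA).
apply/derivable_mxP => i j; under eq_fun do rewrite mxE /cofactor.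
have /derivableP dd : derivable (fun x => \det (row' j (col' i (M x)))) t 1.
  apply: derivable_det; apply/derivable_mxP => k l.
  under eq_fun do rewrite 2!mxE.
  by move: k l; move/derivable_mxP: dM => dM k l; exact: dM.
by case: (is_derive_mul_fun (is_derive_cst ((-1) ^+ (j + i) : R) t 1) dd).
Unshelve. all: by end_near. Qed.

(** Once the inverse is known to be derivable, its derivative is read off by
    differentiating [invmx (M x) *m M x = 1]. *)
Lemma is_derive_invmx (R : realType) (n : nat) (M : R -> 'M[R]_n) (t : R)
    (dM : 'M[R]_n) :
  is_derive t 1 M dM -> (\forall x \near t, M x \in unitmx) ->
  is_derive t 1 (fun x => invmx (M x)) (- (invmx (M t) *m dM *m invmx (M t))).
Proof.
move=> dMt Munit; have Mt := nbhs_singleton Munit.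
have [D dV] : exists D, is_derive t 1 (fun x => invmx (M x)) D.
  by eexists; apply: derivableP; apply: derivable_invmx => //; case: dMt.
apply: (is_derive_eq dV).
have dVM := is_derive_mulmx dV dMt.
have d1 : @is_derive R R 'M[R]_n t 1 (fun x => invmx (M x) *m M x) 0.
  apply: near_eq_is_derive (is_derive_cst (1%:M : 'M[R]_n) t 1).
  by near=> x; rewrite /= mulVmx//; near: x.
have /eqP : D *m M t + invmx (M t) *m dM = 0.
  by case: dVM => _ <-; case: d1.
rewrite addr_eq0 => /eqP DM.
by rewrite -[LHS](mulmxK Mt) DM mulNmx.
Unshelve. all: by end_near. Qed.

(** * The integral from 0 *)

Lemma open_mem_lt_gt (R : realType) (J : set R) (x : R) :
  open J -> J x -> (exists2 y, J y & y < x) /\ (exists2 y, J y & x < y).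
Proof.
rewrite openE => Jo /Jo /nbhs_ballP[e /= e0 xeJ].
have e2 : 0 < e / 2 by rewrite divr_gt0.
split; [exists (x - e / 2)|exists (x + e / 2)]; try lra.
  by apply: xeJ; rewrite /ball/= opprD opprK addNKr gtr0_norm//; lra.
by apply: xeJ; rewrite /ball/= opprD addNKr normrN gtr0_norm//; lra.
Qed.

(** [integral_from0] changes its formula at 0, so it is compared near [t] with
    the difference of two integrals based at a point [c] of [J] to the left of
    both 0 and [t], to which the fundamental theorem of calculus applies. *)
Lemma is_derive_integral_from0 (R : realType) (J : set R) (g : R -> R) (t : R) :
  open J -> is_interval J -> J 0 -> (forall x, J x -> {for x, continuous g}) ->
  J t -> is_derive t 1 (integral_from0 g) (g t).
Proof.
move=> Jo Jitv J0 gJ Jt.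
have [c Jc cmin] : exists2 c, J c & c < Num.min 0 t.
  by case: leP => _;
    [case: (open_mem_lt_gt Jo J0)|case: (open_mem_lt_gt Jo Jt)].
have [d Jd dmax] : exists2 d, J d & Num.max 0 t < d.
  by case: leP => _;
    [case: (open_mem_lt_gt Jo Jt)|case: (open_mem_lt_gt Jo J0)].
move: cmin; rewrite lt_min => /andP[c0 ct].
move: dmax; rewrite gt_max => /andP[d0 td].
have cdJ x : x \in `[c, d] -> J x.
  by rewrite in_itv/= => cxd; exact: Jitv Jc Jd _ cxd.
have intg : lebesgue_measure.-integrable `[c, d] (EFin \o g).
  apply: continuous_compact_integrable; first exact: segment_compact.
  by apply: continuous_in_subspaceT => x; rewrite inE/= => /cdJ/gJ.
have intgS (a b : itv_bound R) : (BLeft c <= a)%O -> (b <= BRight d)%O ->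
    lebesgue_measure.-integrable [set` Interval a b] (EFin \o g).
  move=> ca bd; apply: integrableS intg => //.
  by apply: subset_itvScc.
pose F x := \int[lebesgue_measure]_(y in `[c, x]) g y.
have dF : is_derive t 1 F (g t).
  have [dFt dFE] := @continuous_FTC1_closed _ g c t d td intg ct (gJ _ Jt).
  by apply: DeriveDef; [exact: dFt|rewrite -derive1E].
have dF0 : is_derive t 1 (F - cst (F 0)) (g t).
  by apply: is_derive_eq; rewrite subr0.
apply: near_eq_is_derive dF0; near=> x.
have cx : c < x by near: x; exact: lt_nbhsr.
have xd : x < d by near: x; exact: lt_nbhsl.
rewrite /integral_from0 !fctE /F; case: leP => x0.
  rewrite Rintegral_itvB ?bnd_simp// ?(ltW c0)//; last first.
    by apply: intgS => //; rewrite bnd_simp ltW.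
  rewrite Rintegral_itv_obnd_cbnd//.
  by apply: intgS; rewrite bnd_simp// ltW.
rewrite -opprB Rintegral_itvB ?bnd_simp// ?(ltW cx) ?(ltW x0)//; last first.
  by apply: intgS => //; rewrite bnd_simp ltW.
rewrite Rintegral_itv_obnd_cbnd//.
by apply: intgS; rewrite bnd_simp// ltW.
Unshelve. all: by end_near. Qed.

Lemma integral_from0_0 (R : realType) (g : R -> R) : integral_from0 g 0 = 0.
Proof. by rewrite /integral_from0 lexx set_itv1 Rintegral_set1. Qed.

(** * The matrix exponential *)

Lemma cvg_mxP (R : realType) (n m : nat) (u : nat -> 'M[R]_(n, m))
    (l : 'M[R]_(n, m)) :
  u @ \oo --> l <-> forall i j, (fun k => u k i j) @ \oo --> l i j.
Proof.
split=> [ul i j|ulij].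
  apply: (@cvg_comp _ _ _ u (fun M : 'M[R]_(n, m) => M i j) _ (nbhs l)) => //.
  exact: coord_continuous.
apply/cvgrPdist_le => /= e e0; near=> k.
rewrite /Num.Def.normr/= mx_normrE (bigmax_le _ (ltW e0))//= => i _.
rewrite !mxE; move: i; near: k; apply: filter_forall => /= i.
exact: ((cvgrPdist_le _ _).1 (ulij i.1 i.2)).
Unshelve. all: by end_near. Qed.

Lemma cvg_sum_fun (R : realType) (I : Type) (r : seq I) (u : I -> nat -> R)
    (l : I -> R) :
  (forall i, u i @ \oo --> l i) ->
  (fun k => \sum_(i <- r) u i k) @ \oo --> \sum_(i <- r) l i.
Proof.
move=> ul; elim: r => [|i r IHr].
  by rewrite big_nil; under eq_fun do rewrite big_nil; exact: cvg_cst.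
by rewrite big_cons; under eq_fun do rewrite big_cons; exact: cvgD.
Qed.

Lemma cvg_mulmx (R : realType) (n m p : nat) (u : nat -> 'M[R]_(n, m))
    (v : nat -> 'M[R]_(m, p)) (l : 'M[R]_(n, m)) (l' : 'M[R]_(m, p)) :
  u @ \oo --> l -> v @ \oo --> l' -> (fun k => u k *m v k) @ \oo --> l *m l'.
Proof.
move=> /cvg_mxP ul /cvg_mxP vl; apply/cvg_mxP => i j.
rewrite mxE; under eq_fun do rewrite mxE.
by apply: cvg_sum_fun => k; apply: cvgM.
Qed.

Lemma cvg_mx_unique (R : realType) (n m : nat) (u : nat -> 'M[R]_(n, m))
    (l l' : 'M[R]_(n, m)) : u @ \oo --> l -> u @ \oo --> l' -> l = l'.
Proof.
move=> /cvg_mxP ul /cvg_mxP ul'; apply/matrixP => i j.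
exact: (cvg_unique _ (ul i j) (ul' i j)).
Qed.

(** Comparison with the exponential series [D * expR (C * `|x|)]. *)
Lemma is_cvg_pseries_fact (R : realType) (c : nat -> R) (C D x : R) :
  (forall k, `|c k| <= D * C ^+ k / k`!%:R) -> cvgn (pseries c x).
Proof.
move=> cD; apply: normed_cvg.
have D0 k : 0 <= D * C ^+ k / k`!%:R by apply: le_trans (cD k).
have eE : (D *: exp_coeff (C * `|x|)) =
    (fun k => D * C ^+ k / k`!%:R * `|x| ^+ k).
  by apply/funext => k; rewrite /exp_coeff fctE /= exprMn /GRing.scale/=; ring.
apply: (@series_le_cvg _ _ (D *: exp_coeff (C * `|x|))) => [k|k|k|] //=.
- by rewrite eE mulr_ge0// exprn_ge0.
- by rewrite eE normrM normrX ler_wpM2r// exprn_ge0.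
- by apply: is_cvg_seriesZ; exact: is_cvg_series_exp_coeff.
Qed.

Lemma exprZmx (R : realType) (n : nat) (A : 'M[R]_n) (s : R) (k : nat) :
  (s *: A) ^+ k = s ^+ k *: A ^+ k.
Proof.
elim: k => [|k IHk]; first by rewrite !expr0 scale1r.
by rewrite !exprS IHk -!mulmxE -scalemxAl -scalemxAr scalerA.
Qed.

(** By induction on [k]: each row sum of the absolute values of the entries of
    [A] is at most their total sum. *)
Lemma norm_exprmx_le (R : realType) (n : nat) (A : 'M[R]_n) (k : nat)
    (i j : 'I_n) :
  `|(A ^+ k) i j| <= (\sum_l \sum_m `|A l m|) ^+ k.
Proof.
set C := \sum_l _; have C0 : 0 <= C by do 2 apply: sumr_ge0 => ? _.
elim: k i j => [|k IHk] i j.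
  by rewrite !expr0 mxE normr_nat lern1; case: eqP.
rewrite !exprS -mulmxE mxE.
apply: (le_trans (ler_norm_sum _ _ _)).
apply: (@le_trans _ _ (\sum_l `|A i l| * C ^+ k)).
  by apply: ler_sum => l _; rewrite normrM ler_wpM2l.
rewrite -mulr_suml ler_wpM2r ?exprn_ge0//.
rewrite /C [leRHS](bigD1 i)//= lerDl.
by do 2 apply: sumr_ge0 => ? _.
Qed.

(** The shift [p] is there so that the family is closed under formal
    differentiation: the entries of A^p e^(sA) are the power series in [s] with
    these coefficients, for every [p]. *)
Definition exprmx_coef (R : realType) (n : nat) (A : 'M[R]_n) (p : nat)
  (i j : 'I_n) (k : nat) : R := (A ^+ (k + p)%N) i j / k`!%:R.

Lemma is_cvg_exprmx_coef (R : realType) (n : nat) (A : 'M[R]_n) (p : nat)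
    (i j : 'I_n) (x : R) : cvgn (pseries (exprmx_coef A p i j) x).
Proof.
set C := \sum_l \sum_m `|A l m|.
apply: (@is_cvg_pseries_fact _ _ C (C ^+ p)) => k.
rewrite /exprmx_coef normrM normfV normr_nat ler_wpM2r// -exprD addnC.
exact: norm_exprmx_le.
Qed.

Lemma pseries_diffs_exprmx_coef (R : realType) (n : nat) (A : 'M[R]_n)
    (p : nat) (i j : 'I_n) :
  pseries_diffs (exprmx_coef A p i j) = exprmx_coef A p.+1 i j.
Proof.
apply/funext => k; rewrite /pseries_diffs /exprmx_coef factS natrM addSnnS.
by rewrite invfM mulrCA; congr (_ * _); rewrite mulVKf.
Qed.

Lemma series_expmx_entry (R : realType) (n : nat) (A : 'M[R]_n) (s : R)
    (i j : 'I_n) (k : nat) :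
  series (fun k => (k`!%:R)^-1 *: (s *: A) ^+ k) k i j =
  pseries (exprmx_coef A 0%N i j) s k.
Proof.
rewrite /series /= summxE; apply: eq_bigr => l _.
by rewrite exprZmx mxE mxE /exprmx_coef/= addn0; ring.
Qed.

Lemma cvg_expmx (R : realType) (n : nat) (A : 'M[R]_n) :
  series (fun k => (k`!%:R)^-1 *: A ^+ k) @ \oo --> expmx A.
Proof.
have [l El] : exists l : 'M[R]_n,
    series (fun k => (k`!%:R)^-1 *: A ^+ k) @ \oo --> l.
  exists (\matrix_(i, j) limn (pseries (exprmx_coef A 0%N i j) 1)).
  apply/cvg_mxP => i j; rewrite mxE.
  rewrite (_ : (fun k => _) = pseries (exprmx_coef A 0%N i j) 1).
    exact: is_cvg_exprmx_coef.
  by apply/funext => k; rewrite -series_expmx_entry scale1r.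
by rewrite /expmx (cvg_lim _ El).
Qed.

Lemma expmx_entry (R : realType) (n : nat) (A : 'M[R]_n) (s : R)
    (i j : 'I_n) :
  expmx (s *: A) i j = limn (pseries (exprmx_coef A 0%N i j) s).
Proof.
have /cvg_mxP/(_ i j)/cvg_lim <- // := @cvg_expmx _ _ (s *: A).
by under eq_fun do rewrite series_expmx_entry.
Qed.

Lemma mulmx_expmx_comm (R : realType) (n : nat) (A B : 'M[R]_n) :
  B *m A = A *m B -> B *m expmx A = expmx A *m B.
Proof.
move=> AB; have ABk k : B *m A ^+ k = A ^+ k *m B.
  elim: k => [|k IHk]; first by rewrite mulmx1 mul1mx.
  by rewrite exprS -mulmxE mulmxA AB -mulmxA IHk mulmxA.
apply: cvg_mx_unique (cvg_mulmx (cvg_cst B) (@cvg_expmx _ _ A)) _.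
suff -> : (fun k => B *m series (fun k => (k`!%:R)^-1 *: A ^+ k) k) =
    (fun k => series (fun k => (k`!%:R)^-1 *: A ^+ k) k *m B).
  exact: cvg_mulmx (@cvg_expmx _ _ A) (cvg_cst B).
apply/funext => k.
rewrite /series/= mulmx_sumr mulmx_suml; apply: eq_bigr => l _.
by rewrite -scalemxAl -scalemxAr ABk.
Qed.

(** Each entry of e^(xA) is a power series in [x]; differentiating it term by
    term raises the shift of its coefficients by one. *)
Lemma is_derive_expmx (R : realType) (n : nat) (A : 'M[R]_n) (s : R) :
  is_derive s 1 (fun x => expmx (x *: A)) (A *m expmx (s *: A)).
Proof.
apply/is_derive_mxP => i j; under eq_fun do rewrite expmx_entry.
have -> : (A *m expmx (s *: A)) i j =
    limn (pseries (pseries_diffs (exprmx_coef A 0%N i j)) s).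
  have /cvg_mxP/(_ i j)/cvg_lim <- // :
      (fun k => A *m series (fun k => (k`!%:R)^-1 *: (s *: A) ^+ k) k) @ \oo
        --> A *m expmx (s *: A).
    exact: cvg_mulmx (cvg_cst _) (@cvg_expmx _ _ _).
  apply: (congr1 (fun u : nat -> R => limn u)); apply/funext => k.
  rewrite /series/= mulmx_sumr summxE /pseries /series/=.
  apply: eq_bigr => l _; rewrite pseries_diffs_exprmx_coef /exprmx_coef.
  rewrite /= addn1 exprZmx -!scalemxAr mulmxE -exprS mxE mxE; ring.
apply: (@pseries_snd_diffs _ _ (`|s| + 1));
  rewrite ?pseries_diffs_exprmx_coef; try exact: is_cvg_exprmx_coef.
by rewrite [ltRHS]ger0_norm// ltrDl.
Qed.

Lemma expmx0 (R : realType) (n : nat) : expmx (0 : 'M[R]_n) = 1%:M.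
Proof.
apply: cvg_mx_unique (@cvg_expmx _ _ 0) _.
apply: cvg_near_cst; near=> k.
rewrite /series/= big_ltn//; last by near: k; exact: nbhs_infty_gt.
rewrite fact0 invr1 scale1r expr0 big_nat big1 ?addr0// => l /andP[l0 _].
by rewrite expr0n gtn_eqF// scaler0.
Unshelve. all: by end_near. Qed.

(** The product has derivative
    [A *m e^(tA) *m e^(-tA) - e^(tA) *m A *m e^(-tA)], which
    vanishes as [A] commutes with its exponential. *)
Lemma expmx_mulN (R : realType) (n : nat) (A : 'M[R]_n) (s : R) :
  expmx (s *: A) *m expmx (- s *: A) = 1%:M.
Proof.
pose F x := expmx (x *: A) *m expmx (- x *: A).
have dF (t : R) : is_derive t 1 F 0.
  have dN : is_derive t 1 (fun x : R => - x) (- 1) by exact: is_deriveNid.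
  have dE := is_derive_mx_comp (@is_derive_expmx _ _ A (- t)) dN.
  apply: (is_derive_eq (is_derive_mulmx (@is_derive_expmx _ _ A t) dE)).
  rewrite scaleN1r mulmxN mulmxA -(@mulmx_expmx_comm _ _ _ A) ?subrr//.
  by rewrite -scalemxAl -scalemxAr.
have := @derive0_cst_interval_mx _ _ _ setT F s 0 _
  (fun t _ => dF t) Logic.I Logic.I.
rewrite /F oppr0 !scale0r !expmx0 mulmx1; apply.
by move=> ? ? ? ? ? ?.
Qed.

(** The product is constant, since its derivative is
    [(e^(tA))^T *m (A^T + A) *m e^(tA)]. *)
Lemma expmx_skew_orthogonal (R : realType) (n : nat) (A : 'M[R]_n) (s : R) :
  A^T = - A -> (expmx (s *: A))^T *m expmx (s *: A) = 1%:M.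
Proof.
move=> AT; pose F x := (expmx (x *: A))^T *m expmx (x *: A).
have dF (t : R) : is_derive t 1 F 0.
  have dE := @is_derive_expmx _ _ A t.
  apply: (is_derive_eq (is_derive_mulmx (is_derive_trmx dE) dE)).
  rewrite trmx_mul AT mulmxN mulNmx mulmxA addrC; apply/eqP; rewrite subr_eq0.
  by rewrite eqxx.
have := @derive0_cst_interval_mx _ _ _ setT F s 0 _
  (fun t _ => dF t) Logic.I Logic.I.
rewrite /F !scale0r !expmx0 trmx1 mulmx1; apply.
by move=> ? ? ? ? ? ?.
Qed.

(** * Gram matrices and the evolution of tau, delta, omega and P *)

(** If [x *m a^T *m a = 0] then the sum of the squares of the entries of
    [x *m a^T] is zero, so [x *m a^T = 0], and [a^T] has independent rows. *)
Lemma full_rank_gram_unit (R : realType) (n m : nat) (a : 'M[R]_(n, m)) :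
  full_rank a -> a^T *m a \in unitmx.
Proof.
move=> ra; rewrite -row_free_unit -kermx_eq0; apply/rowV0P => x /sub_kermxP.
rewrite mulmxA => xaa.
have xa0 : x *m a^T = 0.
  have : (x *m a^T) *m (x *m a^T)^T = 0.
    by rewrite trmx_mul trmxK mulmxA xaa mul0mx.
  move=> /matrixP/(_ 0 0); rewrite [LHS]mxE [RHS]mxE => /eqP.
  rewrite psumr_eq0 => [/allP xa0|i _]; last by rewrite [X in _ * X]mxE sqr_ge0.
  apply/rowP => i; have /implyP/(_ isT) := xa0 i (mem_index_enum _).
  by rewrite [X in _ * X]mxE mulf_eq0 orbb => /eqP ->; rewrite mxE.
have : row_free a^T by rewrite -row_leq_rank mxrank_tr ra.
by move=> /row_freeP[B aB]; rewrite -[x]mulmx1 -aB mulmxA xa0 mul0mx.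
Qed.

Lemma trmx_invgram (R : realType) (n m : nat) (a : 'M[R]_(n, m)) :
  (invmx (a^T *m a))^T = invmx (a^T *m a).
Proof. by rewrite trmx_inv trmx_mul trmxK. Qed.

Lemma addmxE (R : realType) (n m : nat) (A B : 'M[R]_(n, m)) i j :
  (A + B) i j = A i j + B i j.
Proof. by rewrite mxE. Qed.

Lemma oppmxE (R : realType) (n m : nat) (A : 'M[R]_(n, m)) i j :
  (- A) i j = - A i j.
Proof. by rewrite mxE. Qed.

Lemma scalemxE (R : realType) (n m : nat) (c : R) (A : 'M[R]_(n, m)) i j :
  (c *: A) i j = c * A i j.
Proof. by rewrite mxE. Qed.

Lemma trmxD (R : realType) (n m : nat) (A B : 'M[R]_(n, m)) :
  (A + B)^T = A^T + B^T.
Proof. exact: linearD. Qed.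

Lemma trmxN (R : realType) (n m : nat) (A : 'M[R]_(n, m)) : (- A)^T = - A^T.
Proof. exact: linearN. Qed.

Lemma trmxZ (R : realType) (n m : nat) (c : R) (A : 'M[R]_(n, m)) :
  (c *: A)^T = c *: A^T.
Proof. exact: linearZ. Qed.

Lemma mxtraceN (R : realType) (n : nat) (A : 'M[R]_n) : \tr (- A) = - \tr A.
Proof. exact: linearN. Qed.

Definition trmx_expandE := (trmxD, trmxN, trmxZ, @trmx_mul, @trmxK).

Definition mx_expandE :=
  (mulmxDl, mulmxDr, mulmxN, mulNmx, =^~ scalemxAl, =^~ scalemxAr,
   mulmx1, mul1mx, mulmxA).

(* Once an identity is expanded into linear combinations of products, reading
   it entrywise makes it an identity between scalars in which every product is
   an atom; [ring] and [field] then decide it, although matrices of different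
   sizes do not form a commutative ring. *)
Ltac mx_entries := apply/matrixP => ? ?; rewrite !(addmxE, oppmxE, scalemxE).

Lemma delta_pinvE (R : realType) (n m : nat) (a v : 'M[R]_(n, m)) :
  full_rank a -> delta (v *m pinv a) = \tr (v *m invmx (a^T *m a) *m v^T).
Proof.
move=> /full_rank_gram_unit aU; rewrite /delta /pinv.
rewrite !trmx_mul trmxK trmx_invgram.
rewrite -!mulmxA mxtrace_mulC !mulmxA -(mulmxA _ (a^T)%R a) mulmxKV//.
by rewrite mxtrace_mulC mulmxA.
Qed.

Lemma tau_pinvE (R : realType) (n m : nat) (a v : 'M[R]_(n, m)) :
  tau (v *m pinv a) = \tr (v *m invmx (a^T *m a) *m a^T).
Proof. by rewrite /tau /pinv mulmxA. Qed.

Lemma omega0E (R : realType) (n m : nat) (a v : 'M[R]_(n, m)) :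
  omega0 a v = a *m invmx (a^T *m a) *m v^T - v *m invmx (a^T *m a) *m a^T.
Proof. by rewrite /omega0 /pinv !trmx_mul trmxK trmx_invgram !mulmxA. Qed.

(** With L = v a^+ this only uses [v = L *m a], which holds because
    [pinv a *m a = 1]; the point is that the right-hand side is linear in [a]
    once [omega0], [P0] and [tau] are known functions of time. *)
Lemma velocity_decomposition (R : realType) (n m : nat) (a v : 'M[R]_(n, m)) :
  full_rank a ->
  v = - (omega0 a v *m a) + a *m P0 a v + (tau (v *m pinv a) / m%:R) *: a.
Proof.
move=> /full_rank_gram_unit aU; rewrite omega0E /P0.
rewrite !mx_expandE -!(mulmxA _ (a^T)%R a) mulmxKV//; mx_entries; ring.
Qed.

Section geodesic_quantities.
Variables (R : realType) (n m : nat) (a v : R -> 'M[R]_(n, m)) (t : R).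
Hypothesis a_t : is_derive t 1 a (v t).
Hypothesis v_t : is_derive t 1 v (geodesic_rhs (a t) (v t)).
Hypothesis a_rank : \forall x \near t, full_rank (a x).

Let G x := invmx ((a x)^T *m a x).
Let dG := - (G t *m (v t)^T *m a t *m G t + G t *m (a t)^T *m v t *m G t).
Let d := \tr (v t *m G t *m (v t)^T).
Let c := \tr (v t *m G t *m (a t)^T).

Let G_unit : (a t)^T *m a t \in unitmx.
Proof. exact: full_rank_gram_unit (nbhs_singleton a_rank). Qed.

Let G_tr : (G t)^T = G t. Proof. exact: trmx_invgram. Qed.

Let G_t : is_derive t 1 G dG.
Proof.
have dS := is_derive_mulmx (is_derive_trmx a_t) a_t.
apply: (is_derive_eq (is_derive_invmx dS _)).
  by near=> x; apply: full_rank_gram_unit; near: x.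
by rewrite /dG -/(G t) !mx_expandE.
Unshelve. all: by end_near. Qed.

(** The terms of L_t other than - tau L are symmetric, and [omega0] is the skew
    part of L up to a factor. *)
Lemma is_derive_omega0 :
  is_derive t 1 (fun x => omega0 (a x) (v x))
    (- tau (v t *m pinv (a t)) *: omega0 (a t) (v t)).
Proof.
under eq_fun do rewrite omega0E.
have aT := is_derive_trmx a_t; have vT := is_derive_trmx v_t.
apply: (is_derive_eq (is_deriveB
  (is_derive_mulmx (is_derive_mulmx a_t G_t) vT)
  (is_derive_mulmx (is_derive_mulmx v_t G_t) aT))).
rewrite /= tau_pinvE omega0E -/(G t) /dG /geodesic_rhs -/(G t) -/c -/d.
rewrite !trmx_expandE !G_tr.
by rewrite !mx_expandE; mx_entries; ring.
Qed.

(** The commutator of L and L^T has trace zero and the projector a G a^T has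
    trace [m]. *)
Lemma is_derive_tau :
  is_derive t 1 (fun x => tau (v x *m pinv (a x)))
    (m%:R / 2 * delta (v t *m pinv (a t)) - tau (v t *m pinv (a t)) ^+ 2).
Proof.
under eq_fun do rewrite tau_pinvE.
apply: (is_derive_eq (is_derive_mxtrace
  (is_derive_mulmx (is_derive_mulmx v_t G_t) (is_derive_trmx a_t)))).
rewrite tau_pinvE delta_pinvE; last exact: nbhs_singleton a_rank.
rewrite -/(G t) /dG /geodesic_rhs -/(G t) -/c -/d.
have tr_aa : \tr (a t *m G t *m (a t)^T) = m%:R.
  by rewrite mxtrace_mulC mulmxA mulmxV// mxtrace1.
have tr_vv : \tr (a t *m G t *m (v t)^T *m v t *m G t *m (a t)^T) = d.
  rewrite -!mulmxA mxtrace_mulC !mulmxA -(mulmxA _ (a t)^T (a t)) mulmxKV//.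
  by rewrite mxtrace_mulC mulmxA.
rewrite !mx_expandE !(mxtraceD, mxtraceN, mxtraceZ) tr_aa tr_vv -/c -/d.
by field.
Qed.

(** After expansion every trace of degree 3 in [v] equals
    [\tr (v *m G *m v^T *m a *m G *m v^T)], up to transposition and cyclic
    permutation, and these terms cancel. *)
Lemma is_derive_delta :
  is_derive t 1 (fun x => delta (v x *m pinv (a x)))
    (- tau (v t *m pinv (a t)) * delta (v t *m pinv (a t))).
Proof.
apply: (@near_eq_is_derive _ _ _ (fun x => \tr (v x *m G x *m (v x)^T))).
  by near=> x; rewrite delta_pinvE//; near: x.
apply: (is_derive_eq (is_derive_mxtrace
  (is_derive_mulmx (is_derive_mulmx v_t G_t) (is_derive_trmx v_t)))).
rewrite tau_pinvE delta_pinvE; last exact: nbhs_singleton a_rank.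
rewrite -/(G t) /dG /geodesic_rhs -/(G t) -/c -/d.
rewrite !trmx_expandE !G_tr !mx_expandE !(mxtraceD, mxtraceN, mxtraceZ) -/c -/d.
pose x := \tr (v t *m G t *m (v t)^T *m a t *m G t *m (v t)^T).
have -> : \tr (v t *m G t *m (a t)^T *m v t *m G t *m (v t)^T) = x.
  by rewrite -mxtrace_tr !trmx_expandE !G_tr !mulmxA.
have -> : \tr (a t *m G t *m (v t)^T *m v t *m G t *m (v t)^T) = x.
  by rewrite -2!mulmxA mxtrace_mulC !mulmxA.
have -> : \tr (v t *m G t *m (v t)^T *m v t *m G t *m (a t)^T) = x.
  rewrite -mxtrace_tr !trmx_expandE !G_tr !mulmxA.
  by rewrite -2!mulmxA mxtrace_mulC !mulmxA.
have -> : \tr (a t *m G t *m (v t)^T) = c.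
  by rewrite -mxtrace_tr !trmx_expandE !G_tr !mulmxA.
rewrite -/x.
by field.
Unshelve. all: by end_near. Qed.

(** With Q = G v^T a the equation gives Q_t = - tau Q + delta / 2, whereas
    (tau / m)_t = - tau (tau / m) + delta / 2: the inhomogeneous terms
    cancel. *)
Lemma is_derive_P0 :
  (0 < m)%N ->
  is_derive t 1 (fun x => P0 (a x) (v x))
    (- tau (v t *m pinv (a t)) *: P0 (a t) (v t)).
Proof.
move=> m_gt0; have m0 : m%:R != 0 :> R by rewrite pnatr_eq0 -lt0n.
have vTa := is_derive_mulmx (is_derive_trmx v_t) a_t.
have dtau : is_derive t 1 (fun x => tau (v x *m pinv (a x)) / m%:R)
    ((m%:R / 2 * delta (v t *m pinv (a t))
      - tau (v t *m pinv (a t)) ^+ 2) / m%:R).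
  apply: (is_derive_eq (is_derive_mul_fun is_derive_tau
    (is_derive_cst (m%:R^-1 : R) t 1))).
  by rewrite /= mulr0 addr0.
apply: (is_derive_eq (is_deriveB (is_derive_mulmx G_t vTa)
  (is_derive_scalemx dtau (is_derive_cst (1%:M : 'M[R]_m) t 1)))).
rewrite /P0 tau_pinvE delta_pinvE; last exact: nbhs_singleton a_rank.
rewrite -/(G t) /dG /geodesic_rhs -/(G t) -/c -/d.
rewrite !trmx_expandE !G_tr !mx_expandE.
have Gaa : G t *m (a t)^T *m a t = 1%:M by rewrite -mulmxA mulVmx.
have GaaK (X : 'M[R]_m) : X *m G t *m (a t)^T *m a t = X.
  by rewrite -!mulmxA (mulmxA (G t)) Gaa mulmx1.
rewrite !GaaK Gaa scaler0 addr0.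
by mx_entries; field.
Qed.
End geodesic_quantities.

(** * Geodesics are given by the formula *)

Lemma is_derive_powR_comp (R : realType) (f : R -> R) (r t df : R) :
  0 < f t -> is_derive t 1 f df ->
  is_derive t 1 (fun x => f x `^ r) (r * (df / f t) * f t `^ r).
Proof.
move=> ft0 dft.
apply: (is_derive_eq (is_derive1_comp (is_derive1_powR r ft0) dft)).
rewrite powRD; last by apply/implyP => _; rewrite gt_eqF.
by rewrite powR_inv1 ?ltW//; ring.
Qed.

Lemma is_derive_geo_f (R : realType) (n m : nat) (a0 v0 : 'M[R]_(n, m))
    (t : R) :
  is_derive t 1 (geo_f a0 v0)
    (m%:R / 2 * delta (v0 *m pinv a0) * t + tau (v0 *m pinv a0)).
Proof.
have did := is_derive_id t (1 : R).
pose k := m%:R * delta (v0 *m pinv a0) / 4.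
have dk x : is_derive t 1 (cst x : R -> R) 0 by exact: is_derive_cst.
apply: (is_derive_eq (is_deriveD (is_deriveD
  (is_derive_mul_fun (dk k) (is_deriveX 2 did))
  (is_derive_mul_fun (dk (tau (v0 *m pinv a0))) did)) (dk 1))).
by rewrite /k /= expr1 /GRing.scale/=; field.
Qed.

Lemma geo_f0 (R : realType) (n m : nat) (a0 v0 : 'M[R]_(n, m)) :
  geo_f a0 v0 0 = 1.
Proof. by rewrite /geo_f expr0n/= !mulr0 !add0r. Qed.

Lemma geo_s0 (R : realType) (n m : nat) (a0 v0 : 'M[R]_(n, m)) :
  geo_s a0 v0 0 = 0.
Proof. exact: integral_from0_0. Qed.

Lemma is_derive_geo_s (R : realType) (n m : nat) (a0 v0 : 'M[R]_(n, m))
    (J : set R) (t : R) :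
  open J -> is_interval J -> J 0 -> (forall x, J x -> 0 < geo_f a0 v0 x) ->
  J t -> is_derive t 1 (geo_s a0 v0) (geo_f a0 v0 t)^-1.
Proof.
move=> Jo Jitv J0 fJ Jt.
have fV_cont x : J x -> {for x, continuous (fun y => (geo_f a0 v0 y)^-1)}.
  move=> Jx; apply/differentiable_continuous/derivable1_diffP/derivableV.
    by rewrite gt_eqF// fJ.
  by case: (is_derive_geo_f a0 v0 x).
exact: (is_derive_integral_from0 Jo Jitv J0 fV_cont Jt).
Qed.

Lemma geodesic_formula0 (R : realType) (n m : nat) (a0 v0 : 'M[R]_(n, m)) :
  geodesic_formula a0 v0 0 = a0.
Proof.
rewrite /geodesic_formula geo_f0 geo_s0 powR1 oppr0 !scale0r !expmx0 scale1r.
by rewrite mul1mx mulmx1.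
Qed.

Section uniqueness.
Variables (R : realType) (n m : nat) (J : set R) (a : R -> 'M[R]_(n, m)).
Hypotheses (m_gt0 : (0 < m)%N) (J_open : open J) (J_itv : is_interval J).
Hypotheses (J_0 : J 0) (a_geo : is_geodesic J a).

Let v := derive1 a.
Let f := geo_f (a 0) (v 0).
Let L x := v x *m pinv (a x).

Let a_t t : J t -> is_derive t 1 a (v t).
Proof.
by move=> /a_geo[_ da _ _]; apply: DeriveDef; [exact: da|rewrite -derive1E].
Qed.

Let v_t t : J t -> is_derive t 1 v (geodesic_rhs (a t) (v t)).
Proof.
move=> /a_geo[_ _ dv vE]; apply: DeriveDef; first exact: dv.
by rewrite -derive1E; exact: vE.
Qed.

Let a_rank t : J t -> \forall x \near t, full_rank (a x).
Proof.
move=> Jt; have : \forall x \near t, J x by exact: open_nbhs_nbhs.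
by apply: filterS => x /a_geo[].
Qed.

Let m0 : m%:R != 0 :> R. Proof. by rewrite pnatr_eq0 -lt0n. Qed.

(** The exponential form makes [phi] positive from the start; it is identified
    with [f] only afterwards. *)
Let phi x := expR (integral_from0 (fun y => tau (L y)) x).

Let phi_t t : J t -> is_derive t 1 phi (phi t * tau (L t)).
Proof.
move=> Jt; apply: is_derive1_comp.
have tau_cont x : J x -> {for x, continuous (fun y => tau (L y))}.
  move=> Jx; apply/differentiable_continuous/derivable1_diffP.
  by case: (is_derive_tau (a_t Jx) (v_t Jx) (a_rank Jx)).
exact: (is_derive_integral_from0 J_open J_itv J_0 tau_cont Jt).
Qed.

Let phi0 : phi 0 = 1. Proof. by rewrite /phi integral_from0_0 expR0. Qed.

Let cst_J (g : R -> R) t :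
  (forall x, J x -> is_derive x 1 g 0) -> J t -> g t = g 0.
Proof. by move=> dg Jt; exact: derive0_cst_interval dg Jt J_0. Qed.

Let phi_delta t : J t -> phi t * delta (L t) = delta (L 0).
Proof.
move=> Jt; rewrite -[RHS]mul1r -phi0.
apply: (cst_J (g := fun x => phi x * delta (L x)) _ Jt) => x Jx.
have dd := is_derive_delta (a_t Jx) (v_t Jx) (a_rank Jx).
apply: (is_derive_eq (is_derive_mul_fun (phi_t Jx) dd)).
by rewrite -/(L x); ring.
Qed.

(** The right-hand side is the derivative of [f]; the left-hand side is that of
    [phi], and its own derivative is [m%:R / 2 * (phi * delta)], a constant. *)
Let phi_tau t :
  J t -> phi t * tau (L t) = m%:R / 2 * delta (L 0) * t + tau (L 0).
Proof.
pose g x := phi x * tau (L x) - (m%:R / 2 * delta (L 0) * x + tau (L 0)).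
have g_t x : J x -> is_derive x 1 g 0.
  move=> Jx; have dt := is_derive_tau (a_t Jx) (v_t Jx) (a_rank Jx).
  have dk y : is_derive x 1 (cst y : R -> R) 0 by exact: is_derive_cst.
  apply: (is_derive_eq (is_deriveB (is_derive_mul_fun (phi_t Jx) dt)
    (is_deriveD (is_derive_mul_fun (dk (m%:R / 2 * delta (L 0)))
      (is_derive_id x (1 : R))) (dk (tau (L 0)))))).
  by rewrite -/(L x) -(phi_delta Jx) /cst; ring.
move=> Jt; have := cst_J g_t Jt.
rewrite /g phi0 mul1r mulr0 add0r subrr => /eqP.
by rewrite subr_eq0 => /eqP.
Qed.

Let phiE t : J t -> phi t = f t.
Proof.
have g_t x : J x -> is_derive x 1 (phi - f) 0.
  move=> Jx.
  apply: (is_derive_eq (is_deriveB (phi_t Jx) (is_derive_geo_f (a 0) (v 0) x))).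
  by rewrite phi_tau// subrr.
move=> Jt; have := cst_J g_t Jt.
rewrite /= !fctE phi0 /f geo_f0 subrr => /eqP.
by rewrite subr_eq0 => /eqP.
Qed.

Lemma geodesic_geo_f_gt0 t : J t -> 0 < f t.
Proof. by move=> /phiE <-; exact: expR_gt0. Qed.

Let f_t t : J t -> is_derive t 1 f (f t * tau (L t)).
Proof.
move=> Jt; apply: (is_derive_eq (is_derive_geo_f (a 0) (v 0) t)).
by rewrite -phiE// phi_tau.
Qed.

(** As [f] has derivative [tau * f], the product rule gives zero; this is what
    makes [omega0] and [P0] equal to their initial values divided by [f]. *)
Let f_scaled_cst p q (X : R -> 'M[R]_(p, q)) t :
  (forall x, J x -> is_derive x 1 X (- tau (L x) *: X x)) -> J t ->
  f t *: X t = X 0.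
Proof.
move=> dX Jt; rewrite -[RHS]scale1r -(geo_f0 (a 0) (v 0)).
apply: (derive0_cst_interval_mx (M := fun x => f x *: X x) J_itv _ Jt J_0).
move=> x Jx.
apply: (is_derive_eq (is_derive_scalemx (f_t Jx) (dX x Jx))).
by rewrite scalerA -scalerDl mulrN subrr scale0r.
Qed.

Let f_omega0 t : J t -> f t *: omega0 (a t) (v t) = omega0 (a 0) (v 0).
Proof.
move=> Jt; apply: (f_scaled_cst (X := fun x => omega0 (a x) (v x)) _ Jt).
move=> x Jx.
exact: is_derive_omega0 (a_t Jx) (v_t Jx) (a_rank Jx).
Qed.

Let f_P0 t : J t -> f t *: P0 (a t) (v t) = P0 (a 0) (v 0).
Proof.
move=> Jt; apply: (f_scaled_cst (X := fun x => P0 (a x) (v x)) _ Jt) => x Jx.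
exact: is_derive_P0 (a_t Jx) (v_t Jx) (a_rank Jx) m_gt0.
Qed.

(** Undoing the moving frame yields a curve [b] whose derivative vanishes by
    [velocity_decomposition] and the two conservation laws above. *)
Lemma geodesic_formula_unique t : J t -> a t = geodesic_formula (a 0) (v 0) t.
Proof.
pose s := geo_s (a 0) (v 0); pose W := omega0 (a 0) (v 0).
pose P := P0 (a 0) (v 0).
pose b x := f x `^ (- m%:R^-1) *:
  (expmx (s x *: W) *m a x *m expmx (- s x *: P)).
move=> Jt; have f_gt0 := geodesic_geo_f_gt0 Jt.
have bt : b t = a 0.
  have -> : a 0 = b 0.
    rewrite /b /s geo_s0 /f geo_f0 powR1 oppr0 !scale0r !expmx0 scale1r.
    by rewrite mul1mx mulmx1.
  apply: (derive0_cst_interval_mx (M := b) J_itv _ Jt J_0) => x Jx.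
  have fx0 := geodesic_geo_f_gt0 Jx; have fxn0 : f x != 0 by rewrite gt_eqF.
  have ds : is_derive x 1 s (f x)^-1.
    exact: is_derive_geo_s J_open J_itv J_0 geodesic_geo_f_gt0 Jx.
  have dU := is_derive_mx_comp (is_derive_expmx W (s x)) ds.
  have dE := is_derive_mx_comp (s := fun y => - s y)
    (is_derive_expmx P (- s x)) (is_deriveN ds).
  have dp := is_derive_powR_comp (- m%:R^-1) fx0 (f_t Jx).
  apply: (is_derive_eq (is_derive_scalemx dp
    (is_derive_mulmx (is_derive_mulmx dU (a_t Jx)) dE))).
  rewrite {1}(mulmx_expmx_comm (A := s x *: W) (B := W)); last first.
    by rewrite -scalemxAl -scalemxAr.
  have [ra _ _ _] := a_geo Jx.
  rewrite [v x](velocity_decomposition _ ra) -/(L x).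
  move: (expmx (s x *: W)) (expmx (- s x *: P)) => U E.
  rewrite -[W](f_omega0 Jx) -[P](f_P0 Jx).
  move: (omega0 (a x) (v x)) (P0 (a x) (v x)) (tau (L x)) => W' P' tau'.
  rewrite !mx_expandE; mx_entries; rewrite [RHS]mxE.
  by field; rewrite fxn0 m0.
rewrite /geodesic_formula -/f -/s -/W -/P -bt /b.
rewrite -scalemxAr -scalemxAl scalerA -powRD; last first.
  by apply/implyP => _; rewrite gt_eqF.
rewrite subrr powRr0 scale1r !mulmxA.
have -> : expmx (- s t *: W) *m expmx (s t *: W) = 1%:M.
  by apply: mulmx1C; exact: expmx_mulN.
rewrite mul1mx -mulmxA.
have -> : expmx (- s t *: P) *m expmx (s t *: P) = 1%:M.
  by apply: mulmx1C; exact: expmx_mulN.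
by rewrite mulmx1.
Qed.
End uniqueness.

(** * The formula defines a geodesic *)

Lemma invmx_eq (R : realType) (n : nat) (A B : 'M[R]_n) :
  A *m B = 1%:M -> invmx A = B.
Proof.
move=> AB; have [Au _] := mulmx1_unit AB.
by rewrite -[LHS]mulmx1 -AB mulmxA mulVmx// mul1mx.
Qed.

(** The inverse of the Gram matrix turns into h^-2 E^-1 G E^-T, so that in each
    term all inner factors cancel; each term is of degree one in [h], and traces
    are invariant under conjugation by the orthogonal [U]. *)
Lemma geodesic_rhs_equivariant (R : realType) (n m : nat) (h : R)
    (U : 'M[R]_n) (E E' : 'M[R]_m) (a v : 'M[R]_(n, m)) :
  h != 0 -> U^T *m U = 1%:M -> E *m E' = 1%:M -> full_rank a ->
  geodesic_rhs (h *: (U *m a *m E)) (h *: (U *m v *m E)) =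
  h *: (U *m geodesic_rhs a v *m E).
Proof.
move=> h0 UU EE' /full_rank_gram_unit aU; set G := invmx (a^T *m a).
have E'E := mulmx1C EE'.
have UK p (X : 'M[R]_(p, n)) : X *m U^T *m U = X by rewrite -mulmxA UU mulmx1.
have EK p (X : 'M[R]_(p, m)) : X *m E *m E' = X by rewrite -mulmxA EE' mulmx1.
have E'K p (X : 'M[R]_(p, m)) : X *m E'^T *m E^T = X.
  by rewrite -mulmxA -trmx_mul EE' trmx1 mulmx1.
have GK p (X : 'M[R]_(p, m)) : X *m a^T *m a *m G = X.
  by rewrite -(mulmxA _ (a^T)%R a) mulmxK.
have GE : invmx ((h *: (U *m a *m E))^T *m (h *: (U *m a *m E))) =
    h ^- 2 *: (E' *m G *m E'^T).
  apply: invmx_eq; rewrite !trmx_expandE !mx_expandE.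
  rewrite UK EK GK -trmx_mul E'E trmx1.
  by rewrite !scalerA -[RHS]scale1r; congr (_ *: _); field.
rewrite /geodesic_rhs GE !trmx_expandE !mx_expandE !EK !E'K !UK.
rewrite !mxtraceZ -!(mulmxA U) !(mxtrace_mulC U) !UK.
rewrite !mulmxA; mx_entries.
rewrite -/G.
by field.
Qed.

Lemma full_rank_frame (R : realType) (n m : nat) (h : R)
    (U : 'M[R]_n) (E : 'M[R]_m) (a : 'M[R]_(n, m)) :
  h != 0 -> U \in unitmx -> E \in unitmx -> full_rank a ->
  full_rank (h *: (U *m a *m E)).
Proof.
move=> h0 Uu Eu ra; rewrite /full_rank mxrank_scale_nz//.
rewrite mxrankMfree ?row_free_unit// -mxrank_tr trmx_mul.
by rewrite mxrankMfree ?row_free_unit ?unitmx_tr// mxrank_tr.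
Qed.

Section existence.
Variables (R : realType) (n m : nat) (J : set R) (a0 v0 : 'M[R]_(n, m)).
Hypotheses (m_gt0 : (0 < m)%N) (a0_rank : full_rank a0).
Hypotheses (J_open : open J) (J_itv : is_interval J).
Hypotheses (J_0 : J 0) (f_gt0 : forall t, J t -> 0 < geo_f a0 v0 t).

Let f := geo_f a0 v0.
Let df t := m%:R / 2 * delta (v0 *m pinv a0) * t + tau (v0 *m pinv a0).
Let s := geo_s a0 v0.
Let W := omega0 a0 v0.
Let P := P0 a0 v0.
Let U t := expmx (- s t *: W).
Let E t := expmx (s t *: P).

Definition moving_frame (x : R -> 'M[R]_(n, m)) (t : R) : 'M[R]_(n, m) :=
  (f t `^ (m%:R^-1)) *: (U t *m x t *m E t).

Let m0 : m%:R != 0 :> R. Proof. by rewrite pnatr_eq0 -lt0n. Qed.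

(** The frame acts from the left and from the right of [x], so [e^(-s W)] has to
    be commuted past [W], whereas the derivative of [e^(s P)] already has [P]
    on the inner side. *)
Lemma is_derive_moving_frame (x : R -> 'M[R]_(n, m)) (dx : 'M[R]_(n, m)) t :
  J t -> is_derive t 1 x dx ->
  is_derive t 1 (moving_frame x) (moving_frame (fun y => (f y)^-1 *:
    (- (W *m x y) + x y *m P + (df y / m%:R) *: x y) + dx) t).
Proof.
move=> Jt x_t.
have fn0 : f t != 0 by rewrite gt_eqF// f_gt0.
have ds : is_derive t 1 s (f t)^-1.
  exact: is_derive_geo_s J_open J_itv J_0 f_gt0 Jt.
have dU := is_derive_mx_comp (s := fun y => - s y)
  (is_derive_expmx W (- s t)) (is_deriveN ds).
have dE := is_derive_mx_comp (is_derive_expmx P (s t)) ds.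
have dp := is_derive_powR_comp m%:R^-1 (f_gt0 Jt) (is_derive_geo_f a0 v0 t).
apply: (is_derive_eq (is_derive_scalemx dp
  (is_derive_mulmx (is_derive_mulmx dU x_t) dE))).
rewrite (mulmx_expmx_comm (A := - s t *: W) (B := W)); last first.
  by rewrite -scalemxAl -scalemxAr.
rewrite /moving_frame -/(df t) -/f -/(U t) -/(E t).
by rewrite !mx_expandE; mx_entries; field; rewrite fn0 m0.
Qed.

Let beta t := delta (v0 *m pinv a0) / 2 * t.

(** The velocity of the geodesic seen from the moving frame. It comes from
    [W *m a0 = a0 *m P - v0 + (tau / m) *: a0] and [df t - tau = m * beta t]. *)
Let frame_vel t := (f t)^-1 *: (v0 + beta t *: a0).

Lemma geodesic_formulaE : geodesic_formula a0 v0 = moving_frame (cst a0).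
Proof. by []. Qed.

Lemma is_derive_geodesic_formula t :
  J t -> is_derive t 1 (geodesic_formula a0 v0) (moving_frame frame_vel t).
Proof.
move=> Jt; rewrite geodesic_formulaE.
apply: (is_derive_eq (is_derive_moving_frame Jt (is_derive_cst a0 t (1 : R)))).
rewrite /moving_frame; congr (_ *: (_ *m _ *m _)); rewrite /frame_vel addr0.
rewrite (velocity_decomposition v0 a0_rank) -/W -/P /beta /df /cst.
by congr (_ *: _); mx_entries; field.
Qed.

(** The acceleration seen from the moving frame. Both sides agree in the
    coefficients of all matrix products and of [v0]; the coefficients of [a0]
    agree exactly because [f] is the stated quadratic polynomial. *)
Lemma geodesic_rhs_frame_vel t : f t != 0 ->
  geodesic_rhs a0 (frame_vel t) =
  (f t)^-1 *: (- (W *m frame_vel t) + frame_vel t *m P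
    + (df t / m%:R) *: frame_vel t)
  + (- (df t / f t ^+ 2) *: (v0 + beta t *: a0)
     + (f t)^-1 *: (delta (v0 *m pinv a0) / 2 *: a0)).
Proof.
move=> fn0; have aU := full_rank_gram_unit a0_rank.
rewrite /W /P omega0E /P0 /df /beta tau_pinvE delta_pinvE//.
pose G := invmx (a0^T *m a0); rewrite /geodesic_rhs -/G.
have G_tr : G^T = G by exact: trmx_invgram.
have GK : forall p (X : 'M[R]_(p, m)), X *m G *m a0^T *m a0 = X.
  by move=> p X; rewrite -(mulmxA _ (a0^T)%R a0) mulmxKV.
set d := \tr (v0 *m G *m v0^T); set c := \tr (v0 *m G *m a0^T).
have tr_aa : \tr (a0 *m G *m a0^T) = m%:R.
  by rewrite mxtrace_mulC mulmxA mulmxV// mxtrace1.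
have tr_av : \tr (a0 *m G *m v0^T) = c.
  by rewrite -mxtrace_tr !trmx_expandE G_tr mulmxA.
have fE : f t = m%:R * d / 4 * t ^+ 2 + c * t + 1.
  by rewrite /f /geo_f delta_pinvE// tau_pinvE.
rewrite /frame_vel /beta delta_pinvE// -/G -/d !trmx_expandE !mx_expandE.
rewrite !(mxtraceD, mxtraceZ) tr_aa tr_av -/c -/d !GK.
clearbody d c.
(* The denominator 4 of the leading coefficient of [f] is cleared here. *)
have f4 : m%:R * d * t ^+ 2 + c * t * 4 + 4 != 0.
  rewrite (_ : _ + _ = 4 * f t); first by rewrite mulf_neq0// pnatr_eq0.
  by rewrite fE; field.
by rewrite fE; mx_entries; field; rewrite f4 m0.
Qed.

Lemma is_derive_frame_vel t : f t != 0 ->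
  is_derive t 1 frame_vel (- (df t / f t ^+ 2) *: (v0 + beta t *: a0)
     + (f t)^-1 *: (delta (v0 *m pinv a0) / 2 *: a0)).
Proof.
move=> fn0.
have dk x : is_derive t 1 (cst x : R -> R) 0 by exact: is_derive_cst.
have db := is_derive_mul_fun (dk (delta (v0 *m pinv a0) / 2))
  (is_derive_id t 1).
have da : is_derive t 1 (cst a0 : R -> _) 0 by exact: is_derive_cst.
have dv : is_derive t 1 (cst v0 : R -> _) 0 by exact: is_derive_cst.
apply: (is_derive_eq (is_derive_scalemx
  (is_deriveV fn0 (is_derive_geo_f a0 v0 t))
  (is_deriveD dv (is_derive_scalemx db da)))).
rewrite /= scaler0 addr0 add0r mul0r add0r mulr1; congr (_ *: _ + _).
by rewrite /GRing.scale /= -/(df t); field.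
Qed.

(** The velocity is known only on [J], but [J] is a neighbourhood of each of its
    points, so it may be differentiated there. *)
Lemma geodesic_formula_is_geodesic : is_geodesic J (geodesic_formula a0 v0).
Proof.
move=> t Jt.
have fn0 : f t != 0 by rewrite gt_eqF// f_gt0.
have hn0 : f t `^ (m%:R^-1) != 0 by rewrite gt_eqF// powR_gt0// f_gt0.
have EE' : E t *m expmx (- s t *: P) = 1%:M by exact: expmx_mulN.
have UU : (U t)^T *m U t = 1%:M.
  apply: expmx_skew_orthogonal; rewrite /W /omega0.
  by rewrite trmxD trmxN trmxK opprB addrC.
have [_ Uu] := mulmx1_unit UU; have [Eu _] := mulmx1_unit EE'.
have da : is_derive t 1 (derive1 (geodesic_formula a0 v0))
    (moving_frame (fun y => geodesic_rhs a0 (frame_vel y)) t).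
  apply: (@near_eq_is_derive _ _ _ (moving_frame frame_vel)).
    have : \forall x \near t, J x by exact: open_nbhs_nbhs.
    apply: filterS => x Jx; rewrite derive1E.
    by case: (is_derive_geodesic_formula Jx).
  apply: (is_derive_eq (is_derive_moving_frame Jt (is_derive_frame_vel fn0))).
  by rewrite /moving_frame (geodesic_rhs_frame_vel fn0).
split.
- exact: full_rank_frame.
- by case: (is_derive_geodesic_formula Jt).
- by case: da.
- rewrite derive1E; case: da => _ ->.
  rewrite derive1E; case: (is_derive_geodesic_formula Jt) => _ ->.
  rewrite geodesic_formulaE /moving_frame.
  by rewrite (geodesic_rhs_equivariant _ _ UU EE').
Qed.

Lemma derive1_geodesic_formula0 : derive1 (geodesic_formula a0 v0) 0 = v0.
Proof.
rewrite derive1E; case: (is_derive_geodesic_formula J_0) => _ ->.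
rewrite /moving_frame /U /E /s geo_s0 oppr0 !scale0r !expmx0 mul1mx mulmx1.
by rewrite /frame_vel /f geo_f0 powR1 invr1 !scale1r /beta mulr0 scale0r addr0.
Qed.
End existence.

(** * The solution of the geodesic equation *)

Unset Implicit Arguments.

Theorem theorem3p6 (R : realType) (n m : nat) (m_gt0 : (0 < m)%N)
    (le_mn : (m <= n)%N) (a0 v0 : 'M[R]_(n, m)) (a0_rank : full_rank a0)
    (J : set R) (J_open : open J) (J_itv : is_interval J) (J_0 : J 0) :
  (* existence: the formula is a solution wherever [geo_f] stays positive *)
  ((forall t : R, J t -> 0 < geo_f a0 v0 t) ->
     [/\ is_geodesic J (geodesic_formula a0 v0),
         geodesic_formula a0 v0 0 = a0
       & derive1 (geodesic_formula a0 v0) 0 = v0])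
  /\
  (* uniqueness: every solution is given by the formula *)
  (forall a : R -> 'M[R]_(n, m),
     is_geodesic J a -> a 0 = a0 -> derive1 a 0 = v0 ->
     forall t : R, J t -> 0 < geo_f a0 v0 t /\ a t = geodesic_formula a0 v0 t).
Proof.
split=> [f_gt0|a a_geo a00 v00 t Jt].
  split; last exact: derive1_geodesic_formula0 f_gt0.
    exact: geodesic_formula_is_geodesic.
  exact: geodesic_formula0.
rewrite -v00 -a00; split.
  exact: geodesic_geo_f_gt0 J_open J_itv J_0 a_geo _ Jt.
exact: geodesic_formula_unique m_gt0 J_open J_itv J_0 a_geo _ Jt.
Qed.
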